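(* Let $\Gamma$ be a finitely presented group acting by algebraic automorphisms on a reduced irreducible complex affine algebraic variety $M$. Then at least one of the following holds: (1) there exists a nonconstant $\Gamma$-invariant meromorphic (rational) function on $M$; or (2) there exists a point $x\in M$ such that the orbit $\Gamma x$ is Zariski dense in $M$. *)

(* Defs.v *)
From HB Require Import structures.
From mathcomp Require Import all_boot all_algebra.
From mathcomp Require Import reals.
From mathcomp Require Import complex.
From mathcomp Require Import mpoly.
From Stdlib Require Import Relations.Relation_Operators.

Set Implicit Arguments.
Unset Strict Implicit.
Unset Printing Implicit Defensive.

Import GRing.Theory.
Local Open Scope ring_scope.

Definition fp_word (k : nat) := seq ('I_k * bool).

Definition eval_word (G : groupType) (k : nat) (gen : 'I_k -> G)
    (w : fp_word k) : G :=
  foldr (fun l acc => ((if l.2 then (gen l.1)^-1 else gen l.1) * acc)%g)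
        1%g w.

Definition pres_step (k : nat) (rels : seq (fp_word k)) (u v : fp_word k) : Prop :=
  exists (a b r : fp_word k),
    u = a ++ b /\ v = a ++ r ++ b /\
    (r \in rels \/ exists (s : 'I_k) (e : bool), r = [:: (s, e); (s, ~~ e)]).

(* w represents the identity of the group presented by <gens | rels>, i.e.
   w lies in the normal closure of rels in the free group. *)
Definition pres_trivial (k : nat) (rels : seq (fp_word k)) (w : fp_word k) : Prop :=
  clos_refl_sym_trans (fp_word k) (pres_step rels) w [::].

Definition finitely_presented (G : groupType) : Prop :=
  exists (k : nat) (gen : 'I_k -> G) (rels : seq (fp_word k)),
    [/\ (forall g : G, exists w, eval_word gen w = g),
        (forall r, r \in rels -> eval_word gen r = 1%g) &
        (forall w, eval_word gen w = 1%g -> pres_trivial rels w)].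

(* Complex affine varieties (as point sets in C^n, hence reduced).         *)
(* C := R[i] for R : realType (a complete archimedean ordered field, i.e.   *)
(* a copy of the real numbers), so C is the field of complex numbers.       *)

Definition cpoint (R : realType) (n : nat) := 'I_n -> R[i].

Definition zariski_closed (R : realType) (n : nat) (Z : cpoint R n -> Prop) : Prop :=
  exists S : {mpoly R[i][n]} -> Prop,
    forall x, Z x <-> (forall p, S p -> p.@[x] = 0).

Definition affine_variety (R : realType) (n : nat) (M : cpoint R n -> Prop) : Prop :=
  zariski_closed M.

Definition irreducible_variety (R : realType) (n : nat) (M : cpoint R n -> Prop) : Prop :=
  (exists x, M x) /\
  forall Z1 Z2 : cpoint R n -> Prop, zariski_closed Z1 -> zariski_closed Z2 ->
    (forall x, M x -> Z1 x \/ Z2 x) ->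
    (forall x, M x -> Z1 x) \/ (forall x, M x -> Z2 x).

Definition regular_self_map (R : realType) (n : nat) (M : cpoint R n -> Prop)
    (f : cpoint R n -> cpoint R n) : Prop :=
  (exists P : 'I_n -> {mpoly R[i][n]}, forall x, M x -> forall j, f x j = (P j).@[x])
  /\ (forall x, M x -> M (f x)).

(* An action of G on M by algebraic automorphisms: every act g is a regular
   self-map of M and act is a group action on M (so each act g is a regular
   automorphism of M, with regular inverse act g^-1). *)
Definition algebraic_action (R : realType) (n : nat) (G : groupType)
    (M : cpoint R n -> Prop) (act : G -> cpoint R n -> cpoint R n) : Prop :=
  [/\ (forall g, regular_self_map M (act g)),
      (forall x, M x -> act 1%g x = x) &
      (forall g h x, M x -> act (g * h)%g x = act g (act h x))].

(* A nonconstant G-invariant rational function on M, given as p/q with q not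
   identically zero on M. Equality of rational functions on the irreducible
   variety M is equality of cross products as functions on M. *)
Definition has_nonconstant_invariant_rational_function (R : realType) (n : nat)
    (G : groupType) (M : cpoint R n -> Prop) (act : G -> cpoint R n -> cpoint R n)
    : Prop :=
  exists p q : {mpoly R[i][n]},
    [/\ (exists x, M x /\ q.@[x] != 0),
        (forall g x, M x -> p.@[act g x] * q.@[x] = p.@[x] * q.@[act g x]) &
        ~ (exists c : R[i], forall x, M x -> p.@[x] = c * q.@[x])].

Definition orbit_zariski_dense (R : realType) (n : nat) (G : groupType)
    (M : cpoint R n -> Prop) (act : G -> cpoint R n -> cpoint R n)
    (x : cpoint R n) : Prop :=
  forall Z : cpoint R n -> Prop, zariski_closed Z ->
    (forall g, Z (act g x)) -> forall y, M y -> Z y.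

(* Main.v *)
(* For polynomials f_1, ..., f_m and g_1, ..., g_m in the group, consider the matrix
   F(x) = (f_j(g_i x)).  Suppose det F is not identically zero on M and p is not in
   the C-span of the f_j on M.  If no additional row (f_j(g x), p(g x)) raised the
   generic rank, Cramer's rule would give p(g x) = sum_j f_j(g x) C_j(x) / det F(x)
   for all g, and the C_j / det F would be invariant rational functions.  Were they
   all constant, p would be in the span.  So in the absence of nonconstant
   invariants such a matrix exists with f_j spanning the polynomials of degree < d
   on M, for every d; where its determinant D_d is nonzero, no polynomial of degree
   < d vanishes on the orbit of x without vanishing on M.

   It remains to find x in M with all D_d(x) nonzero.  An ideal disjoint from a
   countable multiplicative set s remains so after adjoining x_i - a for a suitable
   constant a: otherwise s_a = u_a (x_i - a) modulo the ideal for every a, and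
   uncountably many a share the same s_a and the same bound on deg u_a, so that the
   u_a are linearly dependent; clearing denominators, s_a times a product of
   factors x_i - b is in the ideal, and each factor can be turned into an element
   of s. *)
Require Import Defs.
From HB Require Import structures.
From mathcomp Require Import all_boot all_order all_algebra.
From mathcomp Require Import boolp classical_sets functions cardinality reals.
From mathcomp Require Import complex.
From mathcomp Require Import mpoly.
From mathcomp Require Import ring lra.

Set Implicit Arguments.
Unset Strict Implicit.
Unset Printing Implicit Defensive.

Import Order.TTheory GRing.Theory Num.Theory.
Local Open Scope ring_scope.

(** * Uncountability of the reals and linear dependence of polynomials *)

(** Cantor's nested intervals: [next] keeps the outer third lying across the midpoint from [u k],
    and the supremum of the left endpoints lies in every interval. *)
Lemma real_uncountable (R : realType) (u : nat -> R) : exists s, forall k, u k != s.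
Proof.
pose next (I : R * R) (c : R) :=
  if c <= (I.1 + I.2) / 2 then ((I.1 + 2 * I.2) / 3, I.2)
  else (I.1, (2 * I.1 + I.2) / 3).
pose fix I k := if k is k'.+1 then next (I k') (u k') else (0, 1).
have lt_I k : (I k).1 < (I k).2.
  elim: k => [|k IHk] /=; first exact: ltr01.
  by rewrite /next; case: ifP => _ /=; lra.
have step_I k : [/\ (I k).1 <= (I k.+1).1, (I k.+1).2 <= (I k).2 &
    ~~ ((I k.+1).1 <= u k <= (I k.+1).2)].
  have := lt_I k; rewrite /= /next.
  by case: ifP => [|/negbT]; rewrite ?real_leNgt ?num_real // => ? ?; split => /=; lra.
have mono k j : (I k).1 <= (I (j + k)%N).1 /\ (I (j + k)%N).2 <= (I k).2.
  elim: j => [|j [IH1 IH2]]; first by rewrite add0n.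
  rewrite addSn; have [H1 H2 _] := step_I (j + k)%N.
  by split; [exact: le_trans H1|exact: le_trans H2 _].
have cross k j : (I k).1 <= (I j).2.
  have [H1 _] := mono k j; have [_ H2] := mono j k.
  by apply: le_trans H1 _; rewrite addnC; apply: le_trans H2; exact: ltW.
pose A := [set (I k).1 | k in [set: nat]]%classic.
have supA : has_sup A.
  split; first by exists (I 0%N).1, 0%N.
  by exists (I 0%N).2 => _ [k _ <-].
exists (sup A) => k; apply/eqP => uk.
have [_ _ /negP[]] := step_I k; apply/andP; rewrite uk; split.
  by apply: sup_upper_bound => //; exists k.+1.
by apply: ge_sup; [case: supA|move=> _ [j _ <-]].
Qed.

Lemma infinite_fiber (R : realType) (T : countType) (h : R -> T) :
  exists t (e : nat -> R), injective e /\ forall k, h (e k) = t.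
Proof.
have [t /infiniteP /card_leP[f]] :
    exists t, infinite_set (h @^-1` [set t])%classic.
  apply: contrapT => noinf.
  have fin t : finite_set (h @^-1` [set t])%classic.
    by apply: contrapT => inf; apply: noinf; exists t.
  have : countable [set: R]%classic.
    have -> : [set: R]%classic = (\bigcup_t (h @^-1` [set t]))%classic.
      by apply/seteqP; split => // x _; exists (h x).
    by apply: bigcup_countable => // t _; exact: finite_set_countable.
  case/countable_injP => f injf.
  (* An inverse of [f], with default value 0 off its range, would enumerate the reals. *)
  have finv k : exists x : R, forall y, f y = k -> x = y.
    have [[y fy]|no] := pselect (exists y, f y = k); last first.
      by exists 0 => y fy; case: no; exists y.
    by exists y => z fz; apply: injf; rewrite ?in_setT // fy fz.
  have [u hu] := choice finv.
  by have [s /(_ (f s))/eqP[]] := real_uncountable u; exact: hu.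
pose g k : [set: nat]%classic := exist _ k (mem_set I).
exists t, (fun k => val (f (g k))); split => [k l|k].
  by move=> /val_inj /(@inj _ _ _ f) -/(_ (mem_set I) (mem_set I)) /(congr1 val).
by have := valP (f (g k)); rewrite inE.
Qed.

(** The coefficient matrix has more rows than columns, hence a nonzero left kernel. Since [msize] is
    the degree plus one, only monomials of degree less than [d] occur. *)
Lemma mpoly_linear_dependence (F : fieldType) (n d N : nat)
    (u : 'I_N -> {mpoly F[n]}) :
  (#|{: 'X_{1..n < d}}| < N)%N -> (forall i, (msize (u i) <= d)%N) ->
  exists c : 'I_N -> F,
    (exists i, c i != 0) /\ \sum_i c i *: u i = 0.
Proof.
move=> ltN szu.
pose A := \matrix_(i < N, j < #|{: 'X_{1..n < d}}|) (u i)@_(enum_val j).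
have : kermx A != 0.
  rewrite kermx_eq0 /row_free; apply/negP => /eqP rkA.
  by have := rank_leq_col A; rewrite rkA leqNgt ltN.
case/rowV0Pn => v /sub_kermxP vA v0.
exists (fun i => v 0 i); split; first exact/rV0Pn.
apply/mpolyP => m; rewrite raddf_sum mcoeff0 /=.
have [ltm|lem] := ltnP (mdeg m) d; last first.
  apply: big1 => i _; rewrite mcoeffZ.
  by rewrite (@memN_msupp_eq0 _ _ (u i)) ?mulr0 // msize_mdeg_ge // (leq_trans (szu i)).
transitivity ((v *m A) 0 (enum_rank (BMultinom ltm))); last by rewrite vA mxE.
rewrite mxE; apply: eq_bigr => i _.
by rewrite mcoeffZ mxE enum_rankK.
Qed.

(** * Ideals avoiding a countable multiplicative family *)

Definition ideal_pred (A : comNzRingType) (I : A -> Prop) : Prop :=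
  [/\ I 0, (forall p q, I p -> I q -> I (p + q)) & (forall a p, I p -> I (a * p))].

Section AvoidingIdeals.

Variables (R : realType) (n : nat) (T : countType) (s : T -> {mpoly R[i][n]}).
Hypothesis s_mul : forall t t', exists t'', s t'' = s t * s t'.
Implicit Types I J : {mpoly R[i][n]} -> Prop.

Definition avoids I := forall t, ~ I (s t).

Lemma ideal_opp I p : ideal_pred I -> I p -> I (- p).
Proof. by case=> _ _ IM /(IM (-1)); rewrite mulN1r. Qed.

Lemma avoids_adjoin I (z : {mpoly R[i][n]}) : ideal_pred I -> avoids I ->
  exists a : R[i], forall t (u : {mpoly R[i][n]}), ~ I (s t - u * (z - a%:MP)).
Proof.
move=> idI avI; have [I0 ID IM] := idI; apply: contrapT => noa.
have ex_tu a : exists tu, I (s tu.1 - tu.2 * (z - a%:MP)).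
  apply: contrapT => notu; apply: noa; exists a => t u Itu.
  by apply: notu; exists (t, u).
have [w Iw] := choice ex_tu.
(* Modulo [I], multiplying by [(w b).2] turns a factor [z - b] into [s (w b).1], so the factors are
   absorbed into the family one at a time. *)
have noprod r t : ~ I (s t * \prod_(b <- r) (z - b%:MP)).
  elim: r t => [|b r IHr] t; first by rewrite big_nil mulr1; exact: avI.
  rewrite big_cons => Ip; have [t' st'] := s_mul t (w b).1.
  apply: (IHr t'); rewrite st'.
  set P := \prod_(_ <- r) _ in Ip *.
  have -> : s t * s (w b).1 * P =
      (s t * P) * (s (w b).1 - (w b).2 * (z - b%:MP)) +
      (w b).2 * (s t * ((z - b%:MP) * P)) by ring.
  by apply: ID; apply: IM.
have [[t d] [e [inj_e he]]] :=
  infinite_fiber (fun x : R =>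
    ((w (real_complex R x)).1, msize (w (real_complex R x)).2)).
pose N := #|{: 'X_{1..n < d}}|.+1.
pose a (k : 'I_N) : R[i] := real_complex R (e k).
have inj_a : injective a by move=> k l [] /inj_e /val_inj.
have wa k : (w (a k)).1 = t by case: (he k).
have [c [[k0 ck0] sum0]] : exists c : 'I_N -> R[i],
    (exists i, c i != 0) /\ \sum_i c i *: (w (a i)).2 = 0.
  apply: (@mpoly_linear_dependence _ _ d) => [//|k].
  by case: (he k) => _ <-.
(* [q] is the numerator of [\sum_k c k / (X - a k)]. At [a k0] only the term of index [k0] survives,
   and it is nonzero because the [a k] are distinct. *)
pose q : {poly R[i]} := \sum_k c k *: \prod_(l | l != k) ('X - (a l)%:P).
have q0 : q != 0.
  apply/eqP => /(congr1 (fun p => p.[a k0])).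
  rewrite horner0 horner_sum (bigD1 k0) //= [X in _ + X]big1 ?addr0; last first.
    move=> k nk; rewrite hornerZ horner_prod (bigD1 k0) 1?eq_sym //=.
    by rewrite hornerXsubC subrr mul0r mulr0.
  move/eqP; rewrite hornerZ mulf_eq0 (negPf ck0) horner_prod prodf_seq_eq0 /=.
  case/hasP => l _ /andP[nl]; rewrite hornerXsubC subr_eq0 => /eqP /inj_a lk.
  by rewrite lk eqxx in nl.
have [r qr] := closed_field_poly_normal q.
have lin (b : R[i]) : horner_alg z ('X - b%:P) = z - b%:MP.
  by rewrite rmorphB /= horner_algX horner_algC -mul_mpolyC mulr1.
apply: (noprod r t).
have -> : s t * \prod_(b <- r) (z - b%:MP) =
    ((lead_coef q)^-1)%:MP * (s t * horner_alg z q).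
  rewrite [in horner_alg _ _]qr linearZ rmorph_prod /=.
  under [in RHS]eq_bigr do rewrite lin.
  rewrite -mul_mpolyC; set P := \prod_(_ <- _) _.
  have lead1 : ((lead_coef q)^-1)%:MP * (lead_coef q)%:MP = 1 :> {mpoly R[i][n]}.
    by rewrite -mpolyCM mulVf ?lead_coef_eq0.
  by rewrite mulr1 -[LHS]mul1r -lead1 -mulrA; congr (_ * _); rewrite mulrCA.
apply: (IM).
(* The subtracted terms add up to a multiple of [\sum_k c k *: (w (a k)).2], which is zero, and
   every summand on the right now lies in [I]. *)
have -> : s t * horner_alg z q = \sum_k (c k)%:MP *
    (\prod_(l | l != k) (z - (a l)%:MP) *
     (s t - (w (a k)).2 * (z - (a k)%:MP))).
  transitivity (\sum_k (c k)%:MP * (\prod_(l | l != k) (z - (a l)%:MP) * s t)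
     - (\sum_k c k *: (w (a k)).2) * \prod_l (z - (a l)%:MP)).
    rewrite sum0 mul0r subr0 linear_sum mulr_sumr; apply: eq_bigr => k _.
    rewrite linearZ rmorph_prod /= -mul_mpolyC.
    under eq_bigr do rewrite lin.
    by rewrite mulr1 mulrCA [s t * _]mulrC.
  rewrite mulr_suml -sumrB; apply: eq_bigr => k _.
  rewrite [\prod_l _](bigD1 k) //= -mul_mpolyC; ring.
by apply: big_ind => // k _; apply/(IM)/(IM); rewrite -(wa k).
Qed.

Lemma avoids_adjoin_all I (r : seq 'I_n) : ideal_pred I -> avoids I ->
  exists J, [/\ ideal_pred J, avoids J, (forall p, I p -> J p) &
    forall i, i \in r -> exists a : R[i], J ('X_i - a%:MP)].
Proof.
move=> idI avI; elim: r => [|i r [J [idJ avJ subJ inJ]]].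
  by exists I; split.
have [a ha] := avoids_adjoin 'X_i idJ avJ.
have [J0 JD JM] := idJ.
exists (fun p => exists u, J (p - u * ('X_i - a%:MP))).
have incl p : J p -> exists u, J (p - u * ('X_i - a%:MP)).
  by exists 0; rewrite mul0r subr0.
split => [|t [u /ha]//|p /subJ/incl//|j].
  split; first exact: incl.
  - move=> p q [u Ju] [v Jv]; exists (u + v).
    have -> : p + q - (u + v) * ('X_i - a%:MP) =
      (p - u * ('X_i - a%:MP)) + (q - v * ('X_i - a%:MP)) by ring.
    exact: JD.
  - move=> b p [u Ju]; exists (b * u).
    have -> : b * p - b * u * ('X_i - a%:MP) = b * (p - u * ('X_i - a%:MP)) by ring.
    exact: JM.
rewrite inE => /orP[/eqP ->|/inJ [b Jb]]; last by exists b; apply: incl.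
by exists a, 1; rewrite mul1r subrr.
Qed.

(** Once [J] contains every [X_i - x i], each polynomial is congruent modulo [J] to its value at
    [x]. As 1 belongs to the family, [J] contains no nonzero constant, so its members vanish at [x];
    an [s t] vanishing at [x] would lie in [J]. *)
Lemma avoids_point I : (exists t, s t = 1) -> ideal_pred I -> avoids I ->
  exists x : cpoint R n,
    (forall p, I p -> p.@[x] = 0) /\ (forall t, (s t).@[x] != 0).
Proof.
move=> [t1 st1] idI avI.
have [J [idJ avJ subJ inJ]] := avoids_adjoin_all (enum 'I_n) idI avI.
have coord i : exists a : R[i], J ('X_i - a%:MP) by apply: inJ; rewrite mem_enum.
have [x Jx] := choice coord.
have [J0 JD JM] := idJ.
have Jeval p : J (p - (p.@[x])%:MP).
  elim/mpolyind: p => [|c m p _ _ Jp]; first by rewrite meval0 mpolyC0 subrr.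
  have JX : J ('X_[m] - ('X_[m].@[x])%:MP).
    pose K p := J (p - (p.@[x])%:MP).
    have K1 : K 1 by rewrite /K meval1 subrr.
    have KM p1 p2 : K p1 -> K p2 -> K (p1 * p2).
      move=> K1' K2'; rewrite /K mevalM rmorphM /=.
      have -> : p1 * p2 - (p1.@[x])%:MP * (p2.@[x])%:MP =
        p2 * (p1 - (p1.@[x])%:MP) + (p1.@[x])%:MP * (p2 - (p2.@[x])%:MP) by ring.
      by apply: JD; apply: JM.
    rewrite -/(K _) mpolyXE_id; apply: (big_ind K) => // i _.
    elim: (m i) => [|k IHk]; first by rewrite expr0.
    by rewrite exprS; apply: KM; rewrite // /K mevalXU.
  rewrite mevalD mevalZ rmorphD rmorphM /= -mul_mpolyC.
  have -> : forall P Q, c%:MP * 'X_[m] + p - (c%:MP * P + Q) =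
      c%:MP * ('X_[m] - P) + (p - Q) by move=> *; ring.
  by apply: JD => //; apply: JM.
have unitJ c : J c%:MP -> c = 0.
  move=> Jc; apply/eqP/negP => /negP c0; apply: (avJ t1); rewrite st1.
  by have := JM (c^-1)%:MP _ Jc; rewrite -rmorphM mulVf // rmorph1.
have diff p q : J p -> J (p - q) -> J q.
  move=> Jp /(ideal_opp idJ) Jpq; have := JD _ _ Jp Jpq.
  by rewrite opprB addrC subrK.
exists x; split => [p /subJ Jp|t]; first exact/unitJ/(diff _ _ Jp)/Jeval.
apply/eqP => st0; apply: (avJ t).
by have := Jeval (s t); rewrite st0 mpolyC0 subr0.
Qed.

End AvoidingIdeals.

(** * Regular functions on an irreducible variety *)

Section RegularFunctions.

Variables (R : realType) (n : nat) (M : cpoint R n -> Prop).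
Implicit Types f h : cpoint R n -> R[i].

(** Only values on [M] matter, so determinants, cofactors and pullbacks can be formed pointwise. *)
Definition regular_on f := exists p : {mpoly R[i][n]}, forall x, M x -> f x = p.@[x].

Lemma regular_cst c : regular_on (fun _ => c).
Proof. by exists c%:MP => x _; rewrite mevalC. Qed.

Lemma regular_meval (p : {mpoly R[i][n]}) : regular_on (fun x => p.@[x]).
Proof. by exists p. Qed.

Lemma regular_add f h : regular_on f -> regular_on h -> regular_on (fun x => f x + h x).
Proof. by move=> [p fp] [q hq]; exists (p + q) => x Mx; rewrite mevalD fp ?hq. Qed.

Lemma regular_mul f h : regular_on f -> regular_on h -> regular_on (fun x => f x * h x).
Proof. by move=> [p fp] [q hq]; exists (p * q) => x Mx; rewrite mevalM fp ?hq. Qed.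

Lemma regular_opp f : regular_on f -> regular_on (fun x => - f x).
Proof. by move=> [p fp]; exists (- p) => x Mx; rewrite mevalN fp. Qed.

Lemma regular_sum (J : finType) (F : J -> cpoint R n -> R[i]) :
  (forall j, regular_on (F j)) -> regular_on (fun x => \sum_j F j x).
Proof.
move=> /choice[p Fp]; exists (\sum_j p j) => x Mx.
by rewrite raddf_sum; apply: eq_bigr => j _; exact: Fp.
Qed.

Lemma regular_prod (J : finType) (F : J -> cpoint R n -> R[i]) :
  (forall j, regular_on (F j)) -> regular_on (fun x => \prod_j F j x).
Proof.
move=> /choice[p Fp]; exists (\prod_j p j) => x Mx.
by rewrite rmorph_prod; apply: eq_bigr => j _; exact: Fp.
Qed.

Lemma regular_det m (A : cpoint R n -> 'M[R[i]]_m) :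
  (forall i j, regular_on (fun x => A x i j)) -> regular_on (fun x => \det (A x)).
Proof.
move=> regA; apply: regular_sum => s; apply: regular_mul; first exact: regular_cst.
exact: regular_prod.
Qed.

Lemma regular_adj m (A : cpoint R n -> 'M[R[i]]_m) i j :
  (forall i j, regular_on (fun x => A x i j)) -> regular_on (fun x => (\adj (A x)) i j).
Proof.
move=> regA.
have [p cof_p] : regular_on (fun x => cofactor (A x) j i).
  apply: regular_mul; first exact: regular_cst.
  apply: regular_det => k l.
  have [p Ap] := regA (lift j k) (lift i l).
  by exists p => x Mx; rewrite !mxE Ap.
by exists p => x Mx; rewrite mxE cof_p.
Qed.

Lemma regular_comp (a : cpoint R n -> cpoint R n) (p : {mpoly R[i][n]}) :
  regular_self_map M a -> regular_on (fun x => p.@[a x]).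
Proof.
move=> [[P aP] _]; exists (p \mPo [tuple P i | i < n]) => x Mx.
rewrite comp_mpoly_meval; apply: meval_eq => i.
by rewrite tnth_mktuple aP.
Qed.

Definition nonzero_on f := exists x, M x /\ f x != 0.

Lemma not_nonzero_on f x : ~ nonzero_on f -> M x -> f x = 0.
Proof. by move=> f0 Mx; apply/eqP/negP => /negP fx; apply: f0; exists x. Qed.

(** If the product vanished on [M], the zero loci of the two factors would cover [M], and one of
    them would contain it. *)
Lemma nonzero_mul f h : irreducible_variety M -> regular_on f -> regular_on h ->
  nonzero_on f -> nonzero_on h -> nonzero_on (fun x => f x * h x).
Proof.
move=> [_ irrM] [p fp] [q hq] [x [Mx fx]] [y [My hy]].
have closed0 (r : {mpoly R[i][n]}) : zariski_closed (fun x => r.@[x] = 0).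
  by exists (eq r) => z; split => [? _ <-//|]; exact.
apply: contrapT => fh0.
have cover z : M z -> p.@[z] = 0 \/ q.@[z] = 0.
  move=> Mz; have /eqP := not_nonzero_on fh0 Mz.
  by rewrite fp // hq // mulf_eq0 => /orP[] /eqP; [left|right].
have [p0|q0] := irrM _ _ (closed0 p) (closed0 q) cover.
  by move/eqP: fx; apply; rewrite fp ?p0.
by move/eqP: hy; apply; rewrite hq ?q0.
Qed.

(** The ideal consists of the polynomials vanishing on [M], the family of the finite products of the
    [D d], indexed by lists so as to be countable. A common zero of the ideal lies in [M] because
    [M] is closed. *)
Lemma very_general_point (D : nat -> {mpoly R[i][n]}) :
  affine_variety M -> irreducible_variety M ->
  (forall d, nonzero_on (fun x => (D d).@[x])) ->
  exists x, M x /\ forall d, (D d).@[x] != 0.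
Proof.
move=> [S defM] irrM nzD.
pose s (l : seq nat) := \prod_(d <- l) D d.
pose I (p : {mpoly R[i][n]}) := forall x, M x -> p.@[x] = 0.
have s_mul l l' : exists l'', s l'' = s l * s l'.
  by exists (l ++ l'); rewrite /s big_cat.
have idI : ideal_pred I.
  split => [x _|p q Ip Iq x Mx|a p Ip x Mx]; first by rewrite meval0.
    by rewrite mevalD Ip ?Iq // addr0.
  by rewrite mevalM Ip ?mulr0.
have avI : avoids s I.
  move=> l Il; suff [x [Mx]] : nonzero_on (fun x => (s l).@[x]) by rewrite Il ?eqxx.
  elim: l {Il} => [|d l IHl].
    by case: irrM => [[x Mx] _]; exists x; rewrite /s big_nil meval1 oner_eq0.
  have [x [Mx sx]] := nonzero_mul irrM (regular_meval _) (regular_meval _) (nzD d) IHl.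
  by exists x; rewrite /s big_cons mevalM.
have [|x [Ix sx]] := avoids_point s_mul _ idI avI.
  by exists [::]; rewrite /s big_nil.
exists x; split => [|d]; last by have := sx [:: d]; rewrite /s big_seq1.
by apply/defM => p Sp; apply: Ix => y /defM; exact.
Qed.

End RegularFunctions.

(* Expand [[A, b], [r, c]] * [[1, - adj A b], [0, det A]]. *)
Lemma det_bordered (K : comNzRingType) m (A : 'M[K]_m) (b : 'cV_m) (r : 'rV_m) (c : K) :
  \det (block_mx A b r c%:M) * \det A =
  \det A * (\det A * c - (r *m (\adj A *m b)) 0 0).
Proof.
pose B := block_mx 1%:M (- (\adj A *m b)) 0 (\det A)%:M : 'M_(m + 1).
have detB : \det B = \det A by rewrite det_ublock det1 mul1r det_scalar1.
rewrite -{1}detB -det_mulmx mulmx_block !mulmx1 !mulmx0 !addr0.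
have -> : A *m - (\adj A *m b) + b *m (\det A)%:M = 0.
  by rewrite mulmxN mulmxA mul_mx_adj mul_scalar_mx mul_mx_scalar addNr.
rewrite det_lblock; congr (_ * _).
rewrite mulmxN -scalar_mxM [r *m _]mx11_scalar -raddfN -raddfD det_scalar1 /=.
by rewrite addrC mulrC [in RHS]mxE mulr1n.
Qed.

(** * Generic rank of orbit matrices *)

Section Orbits.

Variables (R : realType) (n : nat) (G : groupType).
Variables (M : cpoint R n -> Prop) (act : G -> cpoint R n -> cpoint R n).
Hypothesis irrM : irreducible_variety M.
Hypothesis actM : algebraic_action M act.
Hypothesis noinv : ~ has_nonconstant_invariant_rational_function M act.

Definition orbit_mx m (f : 'I_m -> {mpoly R[i][n]}) (g : 'I_m -> G) x :=
  \matrix_(i, j) (f j).@[act (g i) x].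

Definition spanned m (f : 'I_m -> {mpoly R[i][n]}) (p : {mpoly R[i][n]}) :=
  exists c : 'I_m -> R[i], forall x, M x -> p.@[x] = \sum_j c j * (f j).@[x].

Lemma regular_act g p : regular_on M (fun x => p.@[act g x]).
Proof. by case: actM => reg _ _; exact: regular_comp. Qed.

Lemma regular_det_orbit_mx m (f : 'I_m -> {mpoly R[i][n]}) g :
  regular_on M (fun x => \det (orbit_mx f g x)).
Proof.
apply: regular_det => i j; have [p fp] := regular_act (g i) (f j).
by exists p => x Mx; rewrite mxE fp.
Qed.

Lemma extend_orbit_mx m (f : 'I_m -> {mpoly R[i][n]}) (g : 'I_m -> G) p :
  nonzero_on M (fun x => \det (orbit_mx f g x)) -> ~ spanned f p ->
  exists (f' : 'I_(m + 1) -> {mpoly R[i][n]}) (g' : 'I_(m + 1) -> G),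
    [/\ nonzero_on M (fun x => \det (orbit_mx f' g' x)),
        (forall j, f' (lshift 1 j) = f j) & f' (rshift m ord0) = p].
Proof.
move=> nzdet nspan; have [act_reg act1 actMM] := actM.
have act_in h x : M x -> M (act h x) by case: (act_reg h) => _; exact.
pose b x := \col_i p.@[act (g i) x].
pose r h x := \row_j (f j).@[act h x].
pose C x := \adj (orbit_mx f g x) *m b x.
(* Where [\det (orbit_mx f g x)] is nonzero, [det_bordered] identifies [e h x] with the determinant
   of that matrix bordered by the row of [h] and the column of [p]. *)
pose e h x := \det (orbit_mx f g x) * p.@[act h x] - (r h x *m C x) 0 0.
have regC j : regular_on M (fun x => C x j 0).
  have [q Cq] : regular_on M
      (fun x => \sum_i (\adj (orbit_mx f g x)) j i * p.@[act (g i) x]).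
    apply: regular_sum => i; apply: regular_mul; last exact: regular_act.
    apply: regular_adj => k l; have [q fq] := regular_act (g k) (f l).
    by exists q => x Mx; rewrite mxE fq.
  exists q => x Mx; rewrite mxE -Cq //.
  by apply: eq_bigr => i _; rewrite [b x i 0]mxE.
have rege h : regular_on M (e h).
  apply: regular_add.
    by apply: regular_mul; [exact: regular_det_orbit_mx|exact: regular_act].
  apply: regular_opp.
  have [q rq] : regular_on M (fun x => \sum_j (f j).@[act h x] * C x j 0).
    by apply: regular_sum => j; apply: regular_mul => //; exact: regular_act.
  by exists q => x Mx; rewrite mxE -rq //; apply: eq_bigr => j _; rewrite mxE.
have [[h nze]|alle0] := pselect (exists h, nonzero_on M (e h)).
  exists (fun j => if fintype.split j is inl j' then f j' else p).
  exists (fun i => if fintype.split i is inl i' then g i' else h).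
  split; [|by move=> j; rewrite (unsplitK (inl j))|by rewrite (unsplitK (inr ord0))].
  have [x [Mx nz]] := nonzero_mul irrM (regular_det_orbit_mx f g) (rege h) nzdet nze.
  exists x; split=> //.
  have -> : orbit_mx (fun j => if fintype.split j is inl j' then f j' else p)
      (fun i => if fintype.split i is inl i' then g i' else h) x =
      block_mx (orbit_mx f g x) (b x) (r h x) (p.@[act h x])%:M.
    apply/matrixP => i j; rewrite !mxE.
    by case: splitP => i' _; rewrite !mxE; case: splitP => j' _; rewrite !mxE // !ord1.
  apply: contra_neq nz => det0.
  by rewrite -det_bordered det0 mul0r.
have e0 h x : M x ->
    \det (orbit_mx f g x) * p.@[act h x] =
    \sum_j (f j).@[act h x] * C x j 0.
  move=> Mx; have /eqP := not_nonzero_on (fun nz => alle0 (ex_intro _ h nz)) Mx.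
  rewrite subr_eq0 => /eqP ->; rewrite mxE.
  by apply: eq_bigr => j _; rewrite mxE.
(* Applying [e0] to [g i * h^-1] at the point [act h x] leads back to [act (g i) x], so
   [C (act h x)] solves a multiple of the linear system at [x]; the adjugate then recovers it. *)
have invC h x : M x ->
    \det (orbit_mx f g x) *: C (act h x) = \det (orbit_mx f g (act h x)) *: C x.
  move=> Mx; rewrite -mul_scalar_mx -mul_adj_mx -mulmxA.
  have -> : orbit_mx f g x *m C (act h x) = \det (orbit_mx f g (act h x)) *: b x.
    apply/matrixP => i k; rewrite ord1 !mxE.
    have := e0 (g i * h^-1)%g (act h x) (act_in h x Mx).
    rewrite -actMM // -mulgA mulVg mulg1 => ->.
    by apply: eq_bigr => j _; rewrite mxE.
  by rewrite -scalemxAr.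
have [q detq] := regular_det_orbit_mx f g.
(* By [invC] the quotient of [C x j 0] by the determinant is invariant, hence constant by
   [noinv]. *)
have constC j : exists c, forall x, M x -> C x j 0 = c * \det (orbit_mx f g x).
  have [pj Cpj] := regC j; apply: contrapT => nc; apply: noinv; exists pj, q; split.
  - by case: nzdet => x [Mx dx]; exists x; rewrite -detq.
  - move=> h x Mx; have Mhx := act_in h x Mx.
    rewrite -!Cpj // -!detq //.
    have /matrixP/(_ j 0) := invC h x Mx; rewrite 2!mxE [RHS]mxE => Hj.
    by rewrite mulrC Hj mulrC.
  - by case=> c cq; apply: nc; exists c => x Mx; rewrite Cpj // detq // cq.
have [c Cc] := choice constC.
case: nspan; exists c => x Mx; apply/eqP; rewrite -subr_eq0; apply/eqP.
pose d x := p.@[x] - \sum_j c j * (f j).@[x].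
have regd : regular_on M d.
  apply: regular_add; first exact: regular_meval.
  apply: regular_opp; apply: regular_sum => j.
  by apply: regular_mul; [exact: regular_cst|exact: regular_meval].
rewrite -/(d x); apply: not_nonzero_on Mx => nzd.
(* Taking [h = 1] in [e0] shows that the determinant times [d] vanishes on [M]; irreducibility
   allows the determinant to be cancelled. *)
have [y [My /eqP[]]] := nonzero_mul irrM (regular_det_orbit_mx f g) regd nzdet nzd.
rewrite mulrBr; apply/eqP; rewrite subr_eq0; apply/eqP.
have := e0 1%g y My; rewrite act1 // => ->.
rewrite mulr_sumr; apply: eq_bigr => j _; rewrite Cc //; ring.
Qed.

(** Greedy construction from the empty matrix, whose determinant is 1: a polynomial already spanned
    is skipped, any other one adds a row and a column. *)
Lemma spanning_orbit_mx (s : seq {mpoly R[i][n]}) :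
  exists m (f : 'I_m -> {mpoly R[i][n]}) (g : 'I_m -> G),
    nonzero_on M (fun x => \det (orbit_mx f g x)) /\
    forall p, p \in s -> spanned f p.
Proof.
elim: s => [|p s [m [f [g [nzdet spans]]]]].
  exists 0%N, (fun=> 0), (fun=> 1%g); split => //.
  by case: irrM => [[x Mx] _]; exists x; rewrite det_mx00 oner_eq0.
have [spp|nsp] := pselect (spanned f p).
  by exists m, f, g; split => // q; rewrite inE => /orP[/eqP ->|/spans].
have [f' [g' [nzdet' f'l f'r]]] := extend_orbit_mx nzdet nsp.
exists (m + 1)%N, f', g'; split => // q; rewrite inE => /orP[/eqP ->|/spans [c qc]].
  exists (fun j => (j == rshift m ord0)%:R) => x Mx.
  rewrite (bigD1 (rshift m ord0)) //= eqxx mul1r f'r big1 ?addr0 // => j /negPf ->.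
  by rewrite mul0r.
exists (fun j => if fintype.split j is inl j' then c j' else 0) => x Mx.
rewrite big_split_ord big_ord1 /= (unsplitK (inr ord0)) mul0r addr0 qc //.
by apply: eq_bigr => j _; rewrite (unsplitK (inl j)) f'l.
Qed.

(** On [M], [p] is a combination of the [f j]. Its vanishing at the points [act (g i) x] puts the
    coefficient vector in the kernel of the orbit matrix at [x], which is invertible when [D.@[x]]
    is nonzero. *)
Lemma orbit_vanishing_degree d : exists D : {mpoly R[i][n]},
  nonzero_on M (fun x => D.@[x]) /\
  forall x p, M x -> D.@[x] != 0 -> (msize p <= d)%N ->
    (forall g, p.@[act g x] = 0) -> forall y, M y -> p.@[y] = 0.
Proof.
have [act_reg _ _] := actM.
have [m [f [g [nzdet spans]]]] :=
  spanning_orbit_mx [seq 'X_[bmnm k] | k <- enum {: 'X_{1..n < d}}].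
have [D detD] := regular_det_orbit_mx f g.
exists D; split => [|x p Mx Dx szp orb0 y My].
  by case: nzdet => x [Mx dx]; exists x; rewrite -detD.
have [c pc] : spanned f p.
  have /choice[c Xc] : forall k : 'X_{1..n < d}, spanned f 'X_[k].
    by move=> k; apply: spans; apply/mapP; exists k; rewrite ?mem_enum.
  exists (fun j => \sum_(k : 'X_{1..n < d}) p@_k * c k j) => z Mz.
  rewrite {1}(mpolywE szp) raddf_sum /=.
  under eq_bigr do rewrite mevalZ Xc // mulr_sumr.
  rewrite exchange_big /=; apply: eq_bigr => j _.
  by rewrite mulr_suml; apply: eq_bigr => k _; rewrite mulrA.
suff c0 j : c j = 0 by rewrite pc // big1 // => j _; rewrite c0 mul0r.
pose v := \col_j c j.
have Av : orbit_mx f g x *m v = 0.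
  apply/matrixP => i k; rewrite !mxE -[RHS](orb0 (g i)) pc; last first.
    by case: (act_reg (g i)) => _; exact.
  by apply: eq_bigr => l _; rewrite !mxE mulrC.
have /matrixP/(_ j 0) : v = 0.
  have := mulKmx _ v; move=> /(_ (orbit_mx f g x)) <-; first by rewrite Av mulmx0.
  by rewrite unitmxE unitfE detD.
by rewrite !mxE.
Qed.

End Orbits.

Theorem theorem2p2 (R : realType) (n : nat) (G : groupType)
    (M : cpoint R n -> Prop) (act : G -> cpoint R n -> cpoint R n) :
  finitely_presented G ->
  affine_variety M ->
  irreducible_variety M ->
  algebraic_action M act ->
  has_nonconstant_invariant_rational_function M act \/
  (exists x, M x /\ orbit_zariski_dense M act x).
Proof.
move=> _ affM irrM actM.
have [|noinv] := pselect (has_nonconstant_invariant_rational_function M act).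
  by left.
right; have [D hD] := choice (orbit_vanishing_degree irrM actM noinv).
have [d|x [Mx Dx]] := very_general_point (D := D) affM irrM.
  by have [] := hD d.
exists x; split => // Z [S defZ] orbZ y My; apply/defZ => p Sp.
(* Each equation [p] of [Z] is handled by the determinant belonging to its own size. *)
have [_ /(_ x p Mx (Dx _) (leqnn _))] := hD (msize p); apply => // g.
by have /defZ := orbZ g; exact.
Qed.
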